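(* For each $n\ge 1$, the polynomials $c_{2,n}(x)=\sum_{k=0}^{n} \left[{n\atop k}\right]^{(2)} x^k$ and $s_{2,n}(x)=\sum_{k=0}^{n} \left\{{n\atop k}\right\}^{(2)} x^k$ have $0$ as a root. The zeros of the polynomial sequence $\big(c_{2,n}(x)/x\big)_{n\ge 1}$, and also those of the sequence $\big(s_{2,n}(x)/x\big)_{n\ge 1}$, are simple, interlacing, and lie in the interval $(-1,0)$.
   Context: For integers $n,k\ge 0$: $\left[{n\atop k}\right]^{(2)}$ is the number of permutations of $[n+k]=\{1,\ldots,n+k\}$ with exactly $k$ cycles, all of size $\ge 2$; $\left\{{n\atop k}\right\}^{(2)}$ is the number of set partitions of $[n+k]$ into exactly $k$ blocks, all of size $\ge 2$. The polynomials $c_{2,n}(x)/x$ and $s_{2,n}(x)/x$ have degree $n-1$. The zeros of a sequence of real-rooted polynomials $(f_n)_{n\ge1}$ with $\deg f_n=n-1$ and simple zeros are called interlacing if for every $n\ge 2$, writing the zeros of $f_n$ as $\mu_1<\dots<\mu_{n-1}$ and those of $f_{n+1}$ as $\lambda_1<\dots<\lambda_n$, one has $\lambda_1<\mu_1<\lambda_2<\mu_2<\dots<\mu_{n-1}<\lambda_n$. *)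

(* Defs.v *)
From mathcomp Require Import all_boot all_order all_algebra all_fingroup.
From mathcomp Require Import reals complex.

Set Implicit Arguments.
Unset Strict Implicit.
Unset Printing Implicit Defensive.

Import Order.TTheory GRing.Theory Num.Theory.

Local Open Scope ring_scope.
Local Open Scope complex_scope.

(* Fixed points count as cycles: porbits s contains the singleton orbits. *)
Definition assoc_stirling1 (n k : nat) : nat :=
  #|[set s : 'S_(n + k) |
      (#|porbits s| == k) && [forall C in porbits s, (2 <= #|C|)%N]]|.

Definition assoc_stirling2 (n k : nat) : nat :=
  #|[set P : {set {set 'I_(n + k)}} |
      [&& partition P [set: 'I_(n + k)], #|P| == k
        & [forall B in P, (2 <= #|B|)%N]]]|.

Definition c2 (R : realType) (n : nat) : {poly R} :=
  \sum_(k < n.+1) (assoc_stirling1 n k)%:R *: 'X^k.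

Definition s2 (R : realType) (n : nat) : {poly R} :=
  \sum_(k < n.+1) (assoc_stirling2 n k)%:R *: 'X^k.

Definition complexify (R : realType) (f : {poly R}) : {poly R[i]} :=
  map_poly (real_complex R) f.

Definition real_rooted (R : realType) (f : {poly R}) : Prop :=
  forall z : R[i], root (complexify f) z -> exists a : R, z = a%:C.

Definition simple_zeros (R : realType) (f : {poly R}) : Prop :=
  forall z : R[i], root (complexify f) z -> mup z (complexify f) = 1%N.

Definition zeros_in_itv (R : realType) (a b : R) (f : {poly R}) : Prop :=
  forall z : R[i], root (complexify f) z ->
    exists2 t : R, z = t%:C & a < t < b.

Definition zero_list (R : realType) (f : {poly R}) (s : seq R) : Prop :=
  sorted <%R s /\ (forall a : R, root f a = (a \in s)).

(* The sequence is indexed from 1; the value f 0 is irrelevant. *)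
Definition interlacing_zeros (R : realType) (f : nat -> {poly R}) : Prop :=
  (forall n : nat, (1 <= n)%N ->
     [/\ size (f n) = n, real_rooted (f n) & simple_zeros (f n)]) /\
  (forall n : nat, (2 <= n)%N ->
     exists mu lambda : seq R,
       [/\ size mu = n.-1 /\ zero_list (f n) mu,
           size lambda = n /\ zero_list (f n.+1) lambda
         & forall i : nat, (i < n.-1)%N -> lambda`_i < mu`_i < lambda`_i.+1]).

(* Main.v *)
(** Both families of numbers satisfy a triangular recurrence, which makes
    [f_n := c_{2,n}/x] and [f_n := s_{2,n}/x] satisfy
    [f_{n+1} = (a_n + (n+2) x) f_n + x (1 + x) f_n'] with [0 < a_n < n + 2]
    ([a_n = n + 1] for permutations, [a_n = 1] for set partitions).
    At a zero of [f_n] in (-1, 0) the values of [f_{n+1}] and [f_n'] have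
    opposite signs; at 0 the values of [f_{n+1}] and [f_n] have the same sign
    and at -1 opposite signs, since [0 < a_n < n + 2].  Hence [f_{n+1}]
    alternates in sign along -1, the zeros of [f_n], and 0, and the
    intermediate value theorem yields all its zeros. *)
Require Import Defs.
From mathcomp Require Import all_boot all_order all_algebra all_fingroup.
From mathcomp Require Import reals complex ring zify.

Set Implicit Arguments.
Unset Strict Implicit.
Unset Printing Implicit Defensive.

Import Order.TTheory GRing.Theory Num.Theory.

(** * Set partitions without singletons *)

Section Partitions.
Variable T : finType.
Implicit Types (A B C : {set T}) (P : {set {set T}}) (k : nat).

Definition partitions2 A k : {set {set {set T}}} :=
  [set P | [&& partition P A, #|P| == k & [forall B in P, (2 <= #|B|)%N]]].

Lemma partitions2P A k P :
  reflect [/\ partition P A, #|P| = k & forall B, B \in P -> (2 <= #|B|)%N]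
          (P \in partitions2 A k).
Proof.
rewrite inE; apply: (iffP and3P) => [[? /eqP ? /forall_inP ?]|[? /eqP ? ?]].
  by split.
by split=> //; apply/forall_inP.
Qed.

(** Deleting the block [B] is a bijection onto [partitions2 (A :\: B) k], with inverse [B |: _].
    That inverse is injective because a non-empty [B] is never a block of a partition of
    [A :\: B]. *)
Lemma card_partitions2_block A B k :
  #|[set P in partitions2 A k.+1 | B \in P]| =
  (if (2 <= #|B|)%N && (B \subset A) then #|partitions2 (A :\: B) k| else 0)%N.
Proof.
case: ifPn => [/andP[B2 sBA]|nB]; last first.
  apply/eqP; rewrite cards_eq0; apply/eqP/setP=> P; rewrite in_set0.
  apply/negbTE; apply: contra nB; rewrite inE => /andP[/partitions2P[pP _ P2] BP].
  by rewrite P2 ?(partitionS pP).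
rewrite -[RHS](card_in_imset (f := fun P => B |: P)); last first.
  have notin P : P \in partitions2 (A :\: B) k -> B \notin P.
    move=> /partitions2P[pP _ _]; apply/negP => /(partitionS pP).
    rewrite subsetD -setI_eq0 setIid => /andP[_ /eqP B0].
    by rewrite B0 cards0 in B2.
  by move=> P Q /notin BP /notin BQ /(congr1 (fun S => S :\ B)); rewrite !setU1K.
congr #|pred_of_set _|; apply/setP=> P; rewrite inE; apply/andP/imsetP.
  move=> [/partitions2P[pP cP P2] BP]; exists (P :\ B); last by rewrite setD1K.
  apply/partitions2P; split; first exact: partitionD1.
    by move: cP; rewrite (cardsD1 B) BP => -[].
  by move=> C /setD1P[_ /P2].
move=> [Q /partitions2P[pQ cQ Q2] ->]; rewrite setU11; split=> //.
have BQ : B \notin Q.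
  apply/negP => /(partitionS pQ).
  rewrite subsetD -setI_eq0 setIid => /andP[_ /eqP B0].
  by rewrite B0 cards0 in B2.
apply/partitions2P; split; last 2 first.
- by rewrite cardsU1 BQ cQ.
- by move=> C /setU1P[->|/Q2].
rewrite -[X in partition _ X](setID A B) setIC (setIidPl sBA).
apply: partitionU1 => //; first by rewrite -card_gt0 (ltn_trans _ B2).
by rewrite disjoint_sym; move: (subxx (A :\: B)); rewrite subsetD => /andP[].
Qed.

Lemma double_count (S : {set {set {set T}}}) (p : pred {set T}) :
  (\sum_(P in S) #|[set B in P | p B]| =
   \sum_(B | p B) #|[set P in S | B \in P]|)%N.
Proof.
under eq_bigr do rewrite -sum1dep_card.
under [RHS]eq_bigr do rewrite -sum1dep_card.
rewrite (exchange_big_dep p) /=; last by move=> ? ? _ /andP[].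
by apply: eq_bigr => B pB; apply: eq_bigl => P; rewrite pB andbT.
Qed.

Lemma card_partitions2_mul A k :
  (k.+1 * #|partitions2 A k.+1| =
   \sum_(B : {set T} | (2 <= #|B|) && (B \subset A))
     #|partitions2 (A :\: B) k|)%N.
Proof.
transitivity (\sum_(P in partitions2 A k.+1) #|[set B in P | predT B]|)%N.
  rewrite mulnC -sum_nat_const; apply: eq_bigr => P /partitions2P[_ <- _].
  by congr #|pred_of_set _|; apply/setP=> B; rewrite inE andbT.
rewrite double_count big_mkcond /= [RHS]big_mkcond /=.
by apply: eq_bigr => B _; rewrite card_partitions2_block.
Qed.

(** Exactly one block contains [a], so summing over the candidates [a |: C] counts each partition
    once; [C] is non-empty because blocks have at least two elements. *)
Lemma card_partitions2_at A a k : a \in A ->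
  #|partitions2 A k.+1| =
  (\sum_(C : {set T} | (0 < #|C|) && (C \subset A :\ a))
     #|partitions2 ((A :\ a) :\: C) k|)%N.
Proof.
move=> aA; transitivity
  (\sum_(P in partitions2 A k.+1) #|[set B in P | a \in B]|)%N.
  rewrite -sum1_card; apply: eq_bigr => P /partitions2P[pP _ _].
  have aP : a \in cover P by rewrite (cover_partition pP).
  apply/esym/eqP/cards1P; exists (pblock P a); apply/setP=> B; rewrite !inE.
  apply/andP/eqP => [[BP aB]|->]; last by rewrite pblock_mem // mem_pblock.
  by rewrite (def_pblock (partition_trivIset pP) BP aB).
rewrite double_count.
rewrite (reindex_onto (fun C => a |: C) (fun B => B :\ a)) /=; last first.
  by move=> B aB; rewrite setD1K.
under eq_bigr do rewrite card_partitions2_block.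
rewrite -big_mkcondr /=; apply: eq_big => [C|C _]; last by rewrite setDDl.
rewrite setU11 /=; have [aC|aC] := boolP (a \in C).
  rewrite subsetD1 aC /= andbF andbF; apply/negbTE/negP => /andP[/eqP e _].
  by move: aC; rewrite -e !inE eqxx.
by rewrite setU1K // eqxx cardsU1 aC subsetD1 aC subUset sub1set aA andbT.
Qed.

(* Counting pairs (partition, block) gives [k.+1 * #|partitions2 A k.+1|] as the
   sum of [#|partitions2 (A :\: B) k|] over all blocks [B]; summing instead over
   the block [a |: C] of [a], the terms with [#|C| >= 2] are that sum for [A :\ a]. *)
Lemma card_partitions2_rec A a k : a \in A ->
  #|partitions2 A k.+1| =
  (k.+1 * #|partitions2 (A :\ a) k.+1| +
   \sum_(b in A :\ a) #|partitions2 ((A :\ a) :\ b) k|)%N.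
Proof.
move=> aA; rewrite (card_partitions2_at _ aA) card_partitions2_mul addnC.
rewrite (bigID (fun C : {set T} => #|C| == 1)%N) /=; congr addn; last first.
  by apply: eq_bigl => C; case: #|C| => [|[|?]]; rewrite ?andbF ?andbT.
rewrite -(big_imset (h := @set1 T)
  (fun C : {set T} => #|partitions2 ((A :\ a) :\: C) k|)) /=; last first.
  by move=> x y _ _ /set1_inj.
apply: eq_bigl => C; apply/andP/imsetP => [[/andP[_ sC] /cards1P[b Cb]]|[b bA ->]].
  by exists b; rewrite // -sub1set -Cb.
by rewrite cards1 sub1set bA.
Qed.

Lemma partitions2_0 k : #|partitions2 set0 k| = (k == 0)%N.
Proof.
have -> : partitions2 set0 k = if k == 0 then [set set0] else set0.
  apply/setP=> P; apply/partitions2P/idP => [[]|].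
    by rewrite partition_set0 => /eqP-> <-; rewrite cards0 eqxx inE.
  case: eqP => [->|]; last by rewrite inE.
  rewrite inE => /eqP->; rewrite cards0 partition_set0; split=> // B.
  by rewrite inE.
by case: eqP => _; rewrite ?cards1 ?cards0.
Qed.

Lemma partitions2_zero A : A != set0 -> #|partitions2 A 0| = 0%N.
Proof.
move=> A0; apply: eq_card0 => P; apply/negP => /partitions2P[pP cP _].
move: (cover_partition pP); rewrite (cards0_eq cP) /cover big_set0 => e.
by rewrite -e eqxx in A0.
Qed.

End Partitions.

(** Indexed by the size [N] of the ground set rather than by [N - k]. A chosen point either joins
    one of [k] blocks of the others or forms a pair with one of the [N2] other points. *)
Fixpoint stirling2_assoc (N k : nat) : nat :=
  match N, k with
  | 0, _ => k == 0
  | _, 0 => 0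
  | 1, _ => 0
  | (N1.+1 as N2).+1, k1.+1 => k * stirling2_assoc N2 k + N2 * stirling2_assoc N1 k1
  end%N.

Lemma card_partitions2 (T : finType) (A : {set T}) k :
  #|partitions2 A k| = stirling2_assoc #|A| k.
Proof.
have [N] := ubnP #|A|; elim: N A k => // N IH A k leAN.
have [A0|[a aA]] := set_0Vmem A; first by rewrite A0 partitions2_0 cards0.
have An0 : A != set0 by apply/set0Pn; exists a.
case: k => [|k].
  by rewrite partitions2_zero //; case: #|A| (cards_eq0 A) An0 => [<-|[]].
have cA : #|A| = #|A :\ a|.+1 by rewrite (cardsD1 a) aA.
have leA1 : (#|A :\ a| < N)%N by move: leAN; rewrite cA ltnS.
rewrite (card_partitions2_rec _ aA) IH // cA.
under eq_bigr => b bA.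
  have cb : #|A :\ a| = #|A :\ a :\ b|.+1 by rewrite (cardsD1 b) bA.
  rewrite IH; last by move: leA1; rewrite cb => /ltnW.
  (* The summand has to be free of [b] for the sum to become a product, so this size is written as
     the predecessor of [#|A :\ a|]. *)
  rewrite -[#|A :\ a :\ b|]/(#|A :\ a :\ b|.+1.-1) -cb.
  over.
rewrite sum_nat_const; case: #|A :\ a| => [|m] //.
by rewrite mul0n addn0 muln0.
Qed.

(** * Permutations with prescribed support *)

Section Permutations.
Variable T : finType.
Implicit Types (A : {set T}) (s t : {perm T}) (k : nat).

Definition moved s : {set T} := [set x | s x != x].

(* The points outside [A] are fixed, hence the [#|~: A|] trivial orbits. *)
Definition perms_moving A k : {set {perm T}} :=
  [set s | (moved s == A) && (#|porbits s| == k + #|~: A|)%N].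

Lemma porbit_fix s x : s x = x -> porbit s x = [set x].
Proof.
move=> sx; apply/setP=> y; rewrite inE; apply/porbitP/eqP => [[i ->]|->].
  exact: permX_fix.
by exists 0%N; rewrite expg0 perm1.
Qed.

(** The points outside [A] already have distinct singleton orbits, and a point [a] of [A] has yet
    another orbit, so there are more than [#|~: A|] orbits. *)
Lemma perms_moving_zero A : A != set0 -> #|perms_moving A 0| = 0%N.
Proof.
move=> /set0Pn[a aA]; apply: eq_card0 => s; apply/negP; rewrite !inE add0n.
move=> /andP[/eqP sA /eqP cs].
have: (#|a |: ~: A| <= #|porbits s|)%N.
  rewrite -(card_in_imset (f := porbit s)); last first.
    have key x y : x \in ~: A -> porbit s x = porbit s y -> x = y.
      rewrite -sA !inE negbK => /eqP/porbit_fix-> e.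
      by have := porbit_id s y; rewrite -e inE => /eqP.
    move=> x y /setU1P[->|xA] /setU1P[->|yA] // e; try exact: key.
    by apply/esym/key.
  by apply/subset_leq_card/subsetP => _ /imsetP[x _ ->]; apply: imset_f.
by rewrite cs cardsU1 inE aA ltnn.
Qed.

Lemma moved_tperm_mul t a c : a != c -> t a = a ->
  moved (tperm a c * t)%g = a |: (c |: moved t).
Proof.
move=> ac ta; apply/setP=> x; rewrite !inE permM.
case: tpermP => [->|->|/eqP xa /eqP xc].
- by rewrite eqxx /= -[X in _ != X]ta (inj_eq perm_inj) eq_sym.
- by rewrite eqxx orbT ta.
- by rewrite (negbTE xa) (negbTE xc).
Qed.

(** The product sends [c] to [a] and [a] to [t c]: the fixed point [a] is inserted after [c], and
    its orbit merges with that of [c]. *)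
Lemma porbits_tperm_mul t a c : a != c -> t a = a ->
  #|porbits t| = #|porbits (tperm a c * t)%g|.+1.
Proof.
move=> ac ta; have := porbits_mul_tperm t a c.
rewrite /= porbit_sym (porbit_fix ta) inE eq_sym ac /= addn1 addn2.
by case.
Qed.

(* Multiplying by [tperm a c], where [c] is the preimage of [a], removes [a] from
   its cycle; [c] becomes fixed as well exactly when that cycle was [(a c)]. *)
Lemma perms_moving_preimage A a c k : a \in A -> c \in A :\ a ->
  [set s in perms_moving A k.+1 | (s^-1)%g a == c] =
  (fun t => tperm a c * t)%g @:
    (perms_moving (A :\ a) k.+1 :|: perms_moving (A :\ a :\ c) k).
Proof.
move=> aA /[dup] cAa /setD1P[ca cA].
have ac : a != c by rewrite eq_sym.
(* Shrinking the support adds one or two fixed points, so both sets on the right demand the same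
   number of orbits, [k + #|~: A| + 2]; only the supports tell them apart. *)
have cD1 : #|~: (A :\ a)| = #|~: A|.+1 by rewrite setCD setUC cardsU1 inE aA.
have cD2 : #|~: (A :\ a :\ c)| = #|~: A|.+2.
  by rewrite setCD setUC cardsU1 inE cAa cD1.
have main t : t a = a ->
    (tperm a c * t \in perms_moving A k.+1)%g =
    (t \in perms_moving (A :\ a) k.+1 :|: perms_moving (A :\ a :\ c) k).
  move=> ta; rewrite !inE moved_tperm_mul // cD1 cD2 (porbits_tperm_mul ac ta).
  rewrite !addnS !eqSS !addSn -andb_orl; congr andb.
  have am : a \notin moved t by rewrite inE ta eqxx.
  apply/eqP/orP => [<-|].
    have [cm|cm] := boolP (c \in moved t); [left|right].
      have -> : c |: moved t = moved t by apply/setUidPr; rewrite sub1set.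
      by rewrite setU1K.
    by rewrite (setU1K (a := a)) ?setU1K // in_setU1 negb_or ac.
  case=> /eqP->; last by rewrite setD1K ?setD1K.
  have -> : c |: (A :\ a) = A :\ a by apply/setUidPr; rewrite sub1set.
  by rewrite setD1K.
apply/setP=> s; rewrite inE; apply/andP/imsetP => [[sA /eqP sc]|[t tU ->]].
  exists (tperm a c * s)%g; last by rewrite mulgA tperm2 mul1g.
  rewrite -main ?mulgA ?tperm2 ?mul1g //.
  by rewrite permM tpermL -sc permKV.
have ta : t a = a.
  apply/eqP; move: tU; rewrite !inE => /orP[] /andP[/eqP mt _].
    by have : a \notin moved t; [rewrite mt !inE eqxx | rewrite inE negbK].
  by have : a \notin moved t; [rewrite mt !inE eqxx andbF | rewrite inE negbK].
rewrite main // tU; split=> //.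
by rewrite invMg tpermV permM -[X in (t^-1)%g X]ta permK tpermL.
Qed.

(** Permutations are classified by the preimage [c] of [a], which differs from [a] because [a] is
    moved. For fixed [c] the two cases are disjoint: [c] lies in only one of the two supports. *)
Lemma card_perms_moving_rec A a k : a \in A ->
  #|perms_moving A k.+1| =
  (\sum_(c in A :\ a)
     (#|perms_moving (A :\ a) k.+1| + #|perms_moving (A :\ a :\ c) k|))%N.
Proof.
move=> aA; rewrite -sum1_card.
rewrite (partition_big (fun s => (s^-1)%g a) [in A :\ a]) /=; last first.
  move=> s; rewrite inE => /andP[/eqP sA _].
  have sa : (s^-1)%g a != a.
    apply: contraTneq aA => e; rewrite -sA inE negbK.
    by rewrite -{1}e permKV.
  by rewrite in_setD1 sa -sA inE permKV eq_sym.
apply: eq_bigr => c cA; rewrite sum1dep_card perms_moving_preimage //.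
rewrite card_imset; last exact: mulgI.
rewrite cardsU [X in (_ - X)%N]eq_card0 ?subn0 // => s.
apply/negbTE/negP; rewrite !inE => /andP[/andP[/eqP-> _] /andP[/eqP e _]].
by move: cA; rewrite e !inE eqxx.
Qed.

Lemma perms_moving_0 k : #|perms_moving set0 k| = (k == 0)%N.
Proof.
have cp : #|porbits (1%g : {perm T})| = #|T|.
  rewrite card_imset // => x y; rewrite !porbit_fix ?perm1 //.
  exact: set1_inj.
have -> : perms_moving set0 k = if k == 0 then [set 1%g] else set0.
  apply/setP=> s; rewrite inE setC0 cardsT.
  have -> : (moved s == set0) = (s == 1%g).
    apply/eqP/eqP => [e|->].
      apply/permP => x; rewrite perm1; apply/eqP/negbNE.
      by have := in_set0 x; rewrite -e inE => ->.
    by apply/setP=> x; rewrite !inE perm1 eqxx.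
  case: (s =P 1%g) => [->|/eqP s1].
    rewrite cp -{1}[#|T|]add0n eqn_add2r eq_sym.
    by case: eqP; rewrite ?in_set1 ?in_set0 ?eqxx.
  by case: ifP; rewrite ?in_set1 ?in_set0 // (negbTE s1).
by case: eqP => _; rewrite ?cards1 ?cards0.
Qed.

End Permutations.

Fixpoint stirling1_assoc (N k : nat) : nat :=
  match N, k with
  | 0, _ => k == 0
  | _, 0 => 0
  | 1, _ => 0
  | (N1.+1 as N2).+1, k1.+1 =>
      N2 * (stirling1_assoc N2 k + stirling1_assoc N1 k1)
  end%N.

Lemma card_perms_moving (T : finType) (A : {set T}) k :
  #|perms_moving A k| = stirling1_assoc #|A| k.
Proof.
have [N] := ubnP #|A|; elim: N A k => // N IH A k leAN.
have [A0|[a aA]] := set_0Vmem A; first by rewrite A0 perms_moving_0 cards0.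
have An0 : A != set0 by apply/set0Pn; exists a.
case: k => [|k].
  by rewrite perms_moving_zero //; case: #|A| (cards_eq0 A) An0 => [<-|[]].
have cA : #|A| = #|A :\ a|.+1 by rewrite (cardsD1 a) aA.
have leA1 : (#|A :\ a| < N)%N by move: leAN; rewrite cA ltnS.
rewrite (card_perms_moving_rec _ aA) cA.
under eq_bigr => b bA.
  have cb : #|A :\ a| = #|A :\ a :\ b|.+1 by rewrite (cardsD1 b) bA.
  rewrite !IH //; last by move: leA1; rewrite cb => /ltnW.
  rewrite -[#|A :\ a :\ b|]/(#|A :\ a :\ b|.+1.-1) -cb.
  over.
by rewrite sum_nat_const; case: #|A :\ a|.
Qed.

(** * Identification with the numbers of the statement *)

Lemma assoc_stirling2E n k : assoc_stirling2 n k = stirling2_assoc (n + k) k.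
Proof. by rewrite -[(n + k)%N in RHS]card_ord -cardsT -card_partitions2. Qed.

(** An orbit of size one is a fixed point, so the size condition says that the support is everything
    and there are no trivial orbits to add. *)
Lemma assoc_stirling1E n k : assoc_stirling1 n k = stirling1_assoc (n + k) k.
Proof.
rewrite -[(n + k)%N in RHS]card_ord -cardsT -card_perms_moving.
congr #|pred_of_set _|; apply/setP=> s; rewrite !inE setCT cards0 addn0 andbC.
congr andb; apply/forall_inP/eqP => [H|/setP H _ /imsetP[x _ ->]].
  apply/setP=> x; rewrite !inE; apply/negP => /eqP sx.
  have /H : porbit s x \in porbits s by apply: imset_f.
  by rewrite porbit_fix // cards1.
have := H x; rewrite !inE => sx; rewrite (cardsD1 x) porbit_id (cardsD1 (s x)).
by rewrite !inE sx; have := mem_porbit s 1 x; rewrite expg1 => ->.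
Qed.

(** * Interlacing *)

Local Open Scope ring_scope.

Section Interlacing.
Variable R : realType.
Implicit Types (f h : {poly R}) (s : seq R).

Lemma prod_sub_gt0 (x : R) s :
  all (< x) s -> 0 < \prod_(b <- s) (x - b).
Proof.
elim: s => [|b s IH] /=; first by rewrite big_nil ltr01.
by move=> /andP[bx /IH H]; rewrite big_cons mulr_gt0 // subr_gt0.
Qed.

Lemma prod_sub_sign (x : R) s :
  all (> x) s -> 0 < (-1) ^+ size s * \prod_(b <- s) (x - b).
Proof.
elim: s => [|b s IH] /=; first by rewrite big_nil mulr1 expr0 ltr01.
move=> /andP[bx /IH H]; rewrite big_cons exprS mulrACA.
by rewrite mulr_gt0 // mulN1r opprB subr_gt0.
Qed.

Lemma ivt_alternating h (y : R) s :
  path <%R y s ->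
  (forall i, (i < size s)%N -> h.[(y :: s)`_i] * h.[s`_i] < 0) ->
  exists t, [/\ size t = size s, all (root h) t
    & forall i, (i < size s)%N -> (y :: s)`_i < t`_i < s`_i].
Proof.
elim: s y => [|z s IH] y /=; first by exists [::].
move=> /andP[yz pzs] H; have [t [st rt Ht]] := IH _ pzs (fun i => H i.+1).
have hyz : h.[y] * h.[z] < 0 := H 0%N isT.
(* [poly_ivt] wants a value at most 0 on the left and at least 0 on the right; scaling by the sign
   of [h.[z]] arranges this without changing the roots. *)
pose e := Num.sg h.[z].
have hy : h.[y] != 0 by apply: contraTneq hyz => ->; rewrite mul0r ltxx.
have hz : h.[z] != 0 by apply: contraTneq hyz => ->; rewrite mulr0 ltxx.
have le0 : (e *: h).[y] <= 0 <= (e *: h).[z].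
  rewrite !hornerZ -normrEsg normr_ge0 andbT.
  rewrite -(pmulr_lle0 _ (_ : 0 < `|h.[z]|)) ?normr_gt0 //.
  by rewrite normrEsg mulrACA -expr2 sqr_sg hz mul1r ltW.
have [x xyz rx] := poly_ivt (ltW yz) le0.
have rhx : root h x.
  by move: rx; rewrite rootZ // sgr_eq0.
exists (x :: t); rewrite /= st rhx rt; split=> // -[|i] /=; last exact: Ht.
move=> _; have /andP[yx xz] := xyz.
rewrite !lt_neqAle yx xz !andbT.
by apply/andP; split; [apply: contraNneq hy => -> | apply: contraNneq hz => <-].
Qed.

(** The invariant of the induction: strict sorting makes the zeros simple, and the positive leading
    coefficient fixes all signs. *)
Definition factored_in_itv f s : Prop :=
  [/\ sorted <%R s, all (fun a => -1 < a < 0) s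
    & exists2 C, 0 < C & f = C *: \prod_(a <- s) ('X - a%:P)].

Lemma deriv_sign_at_root f s j : factored_in_itv f s -> (j < size s)%N ->
  0 < (-1) ^+ (size s - j.+1) * f^`().[s`_j].
Proof.
move=> [ss _ [C C0 ->]] jn; set x := s`_j.
have es : s = take j s ++ x :: drop j.+1 s by rewrite -drop_nth // cat_take_drop.
rewrite -size_drop [in X in X^`()]es.
move: ss; rewrite {1}es (sorted_pairwise lt_trans) pairwise_cat pairwise_cons.
rewrite allrel_consr => /and3P[/andP[lt1 _] _ /andP[lt2 _]].
have hprod u : (\prod_(b <- u) ('X - b%:P)).[x] = \prod_(b <- u) (x - b).
  by rewrite horner_prod; apply: eq_bigr => b _; rewrite hornerXsubC.
rewrite big_cat big_cons /= mulrCA derivZ derivM derivXsubC mul1r !hornerE /=.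
rewrite subrr mul0r addr0 !hprod -mulrA mulrCA mulr_gt0 // mulrCA mulr_gt0 //.
  exact: prod_sub_gt0.
exact: prod_sub_sign.
Qed.

Lemma interlacing_step f s (a b : R) h : factored_in_itv f s -> 0 < a < b ->
  h = (a%:P + b *: 'X) * f + 'X * (1 + 'X) * f^`() ->
  exists t, [/\ size t = (size s).+1, factored_in_itv h t
    & forall i, (i < size s)%N -> t`_i < s`_i < t`_i.+1].
Proof.
move=> fs /andP[a0 ab] hE; have [ss s10 [C C0 fE]] := fs.
have fval x : f.[x] = C * \prod_(b <- s) (x - b).
  rewrite fE hornerZ horner_prod; congr (_ * _).
  by apply: eq_bigr => c _; rewrite hornerXsubC.
have h0 : 0 < h.[0].
  rewrite hE !hornerE /= fval mulr_gt0 // mulr_gt0 // prod_sub_gt0 //.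
  by apply: sub_all s10 => x /andP[].
have hm1 : 0 < (-1) ^+ (size s).+1 * h.[-1].
  have -> : (-1) ^+ (size s).+1 * h.[-1] =
      (b - a) * C * ((-1) ^+ size s * \prod_(c <- s) (-1 - c)).
    by rewrite hE !hornerE /= fval exprS; ring.
  apply: mulr_gt0; first by rewrite mulr_gt0 ?subr_gt0.
  apply: prod_sub_sign.
  by apply: sub_all s10 => x /andP[].
have hs j : (j < size s)%N -> 0 < (-1) ^+ (size s - j) * h.[s`_j].
  move=> js; have dpos := deriv_sign_at_root fs js.
  have rj : f.[s`_j] = 0.
    apply/rootP; rewrite fE rootZ ?gt_eqF // root_prod_XsubC.
    exact: mem_nth.
  have /andP[sj1 sj0] := allP s10 _ (mem_nth 0 js).
  have -> : (-1) ^+ (size s - j) * h.[s`_j] =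
      (- s`_j) * (1 + s`_j) * ((-1) ^+ (size s - j.+1) * f^`().[s`_j]).
    by rewrite hE !hornerE /= rj -(subnSK js) exprS; ring.
  apply: mulr_gt0 => //.
  by rewrite mulr_gt0 ?oppr_gt0 // -ltrBlDl sub0r.
pose y := rcons s 0.
have py : path <%R (-1) y.
  rewrite (path_sortedE lt_trans) /y all_rcons ltrN10 /=; apply/andP; split.
    by apply: sub_all s10 => x /andP[].
  rewrite (sorted_pairwise lt_trans) pairwise_rcons -(sorted_pairwise lt_trans).
  by rewrite ss andbT; apply: sub_all s10 => x /andP[].
have sy : size y = (size s).+1 by rewrite size_rcons.
have sign_at i : (i <= (size s).+1)%N ->
    0 < (-1) ^+ ((size s).+1 - i) * h.[((-1) :: y)`_i].
  case: i => [_|i]; first by rewrite subn0.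
  rewrite subSS ltnS leq_eqVlt /= /y nth_rcons => /predU1P[->|lei].
    by rewrite ltnn eqxx subnn mul1r.
  by rewrite lei; apply: hs.
have alt i : (i < size y)%N -> h.[((-1) :: y)`_i] * h.[y`_i] < 0.
  rewrite sy => lei; have := mulr_gt0 (sign_at i (ltnW lei)) (sign_at i.+1 lei).
  rewrite subSS subSn //= exprS mulrACA -[-1 * _ * _]mulrA -expr2 sqrr_sign.
  by rewrite mulr1 mulN1r oppr_gt0.
have [t [st rt Ht]] := ivt_alternating py alt.
rewrite sy in st.
have t_lt i : (i <= size s)%N -> t`_i < y`_i.
  by rewrite -ltnS -sy => /Ht /andP[].
have t_gt i : (i <= size s)%N -> ((-1) :: y)`_i < t`_i.
  by rewrite -ltnS -sy => /Ht /andP[].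
exists t; split=> //; last first.
  move=> i lei; have := t_gt i.+1 lei; have := t_lt i (ltnW lei).
  by rewrite /= /y nth_rcons lei => -> ->.
have ts : sorted <%R t.
  apply/(sortedP 0) => i; rewrite st ltnS => lei.
  exact: lt_trans (t_lt i (ltnW lei)) (t_gt i.+1 lei).
have t10 : all (fun x => -1 < x < 0) t.
  apply/(all_nthP 0) => i; rewrite st ltnS => lei.
  rewrite (le_lt_trans _ (t_gt i lei)) ?(lt_le_trans (t_lt i lei)) //.
    rewrite /y nth_rcons; case: ltngtP lei => // lei _.
    by have /andP[_ /ltW] := allP s10 _ (mem_nth 0 lei).
  case: i lei => [//|i lei] /=; apply: ltW; apply: (allP (order_path_min lt_trans py)).
  by apply: mem_nth; rewrite sy ltnW.
have h_neq0 : h != 0 by apply: contraTneq h0 => ->; rewrite horner0 ltxx.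
have ut : uniq t by apply: lt_sorted_uniq.
(* The [size s + 1] zeros found bound the degree of [h] from below, the formula for [h] bounds it
   from above; so there are no other zeros. *)
have sh : size h = (size t).+1.
  apply/eqP; rewrite eqn_leq max_poly_roots // andbT.
  have sf : size f = (size s).+1 by rewrite fE size_scale ?gt_eqF // size_prod_XsubC.
  have size2 (u v : R) : (size (u%:P + v *: 'X)%R <= 2)%N.
    rewrite -mul_polyC addrC size_MXaddC; case: ifP => // _.
    by rewrite ltnS size_polyC_leq1.
  have fn0 : f != 0 by rewrite -size_poly_gt0 sf.
  have := lt_size_deriv fn0; rewrite sf ltnS => sd.
  rewrite hE st (leq_trans (size_polyD _ _)) // geq_max.
  apply/andP; split; apply: leq_trans (size_polyMleq _ _) _.
    by rewrite sf addnS /= -[(size s).+2]/(2 + size s)%N leq_add2r size2.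
  have -> : size ('X * (1 + 'X) : {poly R}) = 3.
    have sX : size (1 + 'X : {poly R}) = 2 by rewrite addrC -polyC1 size_XaddC.
    by rewrite mulrC size_mulX ?sX // -size_poly_gt0 sX.
  by rewrite !ltnS.
have hE2 : h = lead_coef h *: \prod_(x <- t) ('X - x%:P).
  by apply: all_roots_prod_XsubC; rewrite ?uniq_rootsE.
split=> //; exists (lead_coef h) => //.
(* All zeros are negative, so the leading coefficient has the sign of [h.[0]]. *)
move: h0; rewrite {1}hE2 hornerZ pmulr_lgt0 // horner_prod.
under eq_bigr do rewrite hornerXsubC.
by apply: prod_sub_gt0; apply: sub_all t10 => x /andP[].
Qed.

(** * Complex zeros and multiplicities read off the real factorisation *)

Lemma factored_root_complex f s (z : R[i]) : factored_in_itv f s ->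
  root (complexify f) z = (z \in map (real_complex R) s).
Proof.
move=> [_ _ [C C0 ->]].
rewrite /complexify map_polyZ map_prod_XsubC rootZ ?fmorph_eq0 ?gt_eqF //.
by rewrite -(big_map (real_complex R) predT (fun x => 'X - x%:P)) root_prod_XsubC.
Qed.

Lemma factored_mup f s (z : R[i]) : factored_in_itv f s ->
  mup z (complexify f) = count_mem z (map (real_complex R) s).
Proof.
move=> [_ _ [C C0 ->]].
rewrite /complexify map_polyZ map_prod_XsubC -mul_polyC mupMr; last first.
  by rewrite rootC fmorph_eq0 gt_eqF.
by rewrite -(big_map (real_complex R) predT (fun x => 'X - x%:P)) mu_prod_XsubC.
Qed.

Lemma factored_zeros f s : factored_in_itv f s ->
  [/\ simple_zeros f, zeros_in_itv (-1) 0 f, real_rooted f,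
      zero_list f s & size f = (size s).+1].
Proof.
move=> fs; have [ss s10 [C C0 fE]] := fs; split.
- move=> z; rewrite (factored_root_complex _ fs) (factored_mup _ fs) => zs.
  by rewrite count_uniq_mem ?zs // map_inj_uniq ?lt_sorted_uniq //; apply: fmorph_inj.
- move=> z; rewrite (factored_root_complex _ fs) => /mapP[x xs ->].
  by exists x; rewrite // (allP s10).
- by move=> z; rewrite (factored_root_complex _ fs) => /mapP[x _ ->]; exists x.
- by split=> // x; rewrite fE rootZ ?gt_eqF // root_prod_XsubC.
- by rewrite fE size_scale ?gt_eqF // size_prod_XsubC.
Qed.

Lemma interlacing_family (f : nat -> {poly R}) (a b : nat -> R) :
  f 1%N = 1 ->
  (forall n, (0 < n)%N -> 0 < a n < b n) ->
  (forall n, (0 < n)%N ->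
     f n.+1 = ((a n)%:P + b n *: 'X) * f n + 'X * (1 + 'X) * (f n)^`()) ->
  [/\ forall n : nat, (1 <= n)%N -> simple_zeros (f n),
      interlacing_zeros f
    & forall n : nat, (1 <= n)%N -> zeros_in_itv (-1) 0 (f n)].
Proof.
move=> f1 ab fS.
have fac n : (0 < n)%N -> exists2 s, size s = n.-1 & factored_in_itv (f n) s.
  case: n => // n _; elim: n => [|n [s sn fs]].
    exists [::] => //; split=> //; exists 1 => //.
    by rewrite big_nil scale1r.
  have [t [st ft _]] := interlacing_step fs (ab n.+1 isT) (fS n.+1 isT).
  by exists t; rewrite // st sn.
split.
- by move=> n /fac[s _ /factored_zeros[]].
- split=> [n n0|n n2].
    have [s sn /factored_zeros[? _ ? _ sf]] := fac n n0.
    by split=> //; rewrite sf sn prednK.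
  have n0 : (0 < n)%N by apply: ltnW.
  have [s sn fs] := fac n n0.
  have [t [st ft H]] := interlacing_step fs (ab n n0) (fS n n0).
  exists s, t; have [_ _ _ ? _] := factored_zeros fs.
  have [_ _ _ ? _] := factored_zeros ft.
  by split=> //; rewrite -?sn // st sn prednK.
- by move=> n /fac[s _ /factored_zeros[]].
Qed.

End Interlacing.

(** * The two recurrences *)

Lemma stirling2_assocS N k :
  stirling2_assoc N.+2 k.+1 =
  (k.+1 * stirling2_assoc N.+1 k.+1 + N.+1 * stirling2_assoc N k)%N.
Proof. by []. Qed.

Lemma stirling1_assocS N k :
  stirling1_assoc N.+2 k.+1 =
  (N.+1 * (stirling1_assoc N.+1 k.+1 + stirling1_assoc N k))%N.
Proof. by []. Qed.

(** Blocks of size at least two leave no room for [k] of them. At [N = n + k] with [n < k] this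
    shows that the sum [s2] omits no nonzero term. *)
Lemma stirling2_assoc_small N k : (N < k.*2)%N -> stirling2_assoc N k = 0%N.
Proof.
have [m] := ubnP N; elim: m N k => // m IH [|[|N]] [|k] // Nm Nk.
rewrite stirling2_assocS !IH ?muln0 //; last exact: ltnW.
exact: ltnW.
Qed.

Lemma stirling1_assoc_small N k : (N < k.*2)%N -> stirling1_assoc N k = 0%N.
Proof.
have [m] := ubnP N; elim: m N k => // m IH [|[|N]] [|k] // Nm Nk.
rewrite stirling1_assocS !IH ?muln0 //; last exact: ltnW.
exact: ltnW.
Qed.

Section Recurrence.
Variables (R : realType) (p : nat -> {poly R}).
Variables (u : nat -> nat -> nat) (a : nat -> nat).
Hypothesis p_def : forall n, p n = \sum_(k < n.+1) (u n k)%:R *: 'X^k.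
Hypothesis u_0 : forall n, (0 < n)%N -> u n 0 = 0%N.
Hypothesis u_gt : forall n k, (n < k)%N -> u n k = 0%N.
Hypothesis u_11 : u 1 1 = 1%N.
Hypothesis u_rec : forall n k, (0 < n)%N ->
  u n.+1 k.+1 = ((a n + k) * u n k.+1 + (n.+1 + k) * u n k)%N.
Hypothesis a_itv : forall n, (0 < n)%N -> (0 < a n < n.+2)%N.

Let q n : {poly R} := \poly_(k < n) (u n k.+1)%:R.

Let coef_q n k : (q n)`_k = (u n k.+1)%:R.
Proof. by rewrite coef_poly; case: ltnP => // nk; rewrite u_gt. Qed.

Let pE n : (0 < n)%N -> p n = q n * 'X.
Proof.
move=> n0; apply/polyP => k.
rewrite coefMX p_def -(poly_def _ (fun k => (u n k)%:R)).
rewrite coef_poly coef_q; case: k => [|k] /=; first by rewrite u_0.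
by case: ltnP => // nk; rewrite u_gt.
Qed.

Let divp_p n : (0 < n)%N -> p n %/ 'X = q n.
Proof. by move=> n0; rewrite pE // mulpK // polyX_eq0. Qed.

Lemma triangular_root0 n : (0 < n)%N -> root (p n) 0.
Proof. by move=> n0; rewrite pE // rootE hornerMX mulr0. Qed.

Lemma triangular_interlacing :
  [/\ forall n : nat, (1 <= n)%N -> simple_zeros (p n %/ 'X),
      interlacing_zeros (fun n : nat => p n %/ 'X)
    & forall n : nat, (1 <= n)%N -> zeros_in_itv (-1) 0 (p n %/ 'X)].
Proof.
apply: (interlacing_family (a := fun n => (a n)%:R) (b := fun n => n.+2%:R)).
- rewrite divp_p //; apply/polyP => k; rewrite coef_q coef1.
  case: k => [|k]; first by rewrite u_11.
  by rewrite u_gt.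
- by move=> n /a_itv /andP[a0 an]; rewrite ltr0n a0 ltr_nat.
- move=> n n0; rewrite !divp_p //; apply/polyP => k.
  have -> : ((a n)%:R%:P + n.+2%:R *: 'X) * q n + 'X * (1 + 'X) * (q n)^`() =
      (a n)%:R *: q n + n.+2%:R *: ('X * q n) +
      ('X * (q n)^`() + 'X * ('X * (q n)^`())).
    by rewrite -!mul_polyC; ring.
  rewrite !coefD !coefZ !coefXM !coef_q u_rec //.
  case: k => [|[|k]] /=; rewrite ?coef_deriv ?coef_q ?u_0 //.
  + by rewrite !addr0 mulr0 addr0 muln0 !addn0 natrM.
  + rewrite !natrD !natrM !natrD -[n.+2%:R]natr1.
    by move: (u n _)%:R (u n _)%:R => x y; ring.
  + rewrite !natrD !natrM !natrD; move: (u n _)%:R (u n _)%:R => x y.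
    rewrite -(mulr_natr x) -(mulr_natr y) -[n.+2%:R]natr1 -[k.+2%:R]natr1.
    by ring.
Qed.

End Recurrence.

Theorem theorem1p6 (R : realType) :
  [/\ forall n : nat, (1 <= n)%N -> root (c2 R n) 0 /\ root (s2 R n) 0,
      [/\ forall n : nat, (1 <= n)%N -> simple_zeros (c2 R n %/ 'X),
          interlacing_zeros (fun n : nat => c2 R n %/ 'X)
        & forall n : nat, (1 <= n)%N -> zeros_in_itv (-1) 0 (c2 R n %/ 'X)]
    & [/\ forall n : nat, (1 <= n)%N -> simple_zeros (s2 R n %/ 'X),
          interlacing_zeros (fun n : nat => s2 R n %/ 'X)
        & forall n : nat, (1 <= n)%N -> zeros_in_itv (-1) 0 (s2 R n %/ 'X)]].
Proof.
have c2E n : c2 R n = \sum_(k < n.+1) (stirling1_assoc (n + k) k)%:R *: 'X^k.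
  by apply: eq_bigr => k _; rewrite assoc_stirling1E.
have s2E n : s2 R n = \sum_(k < n.+1) (stirling2_assoc (n + k) k)%:R *: 'X^k.
  by apply: eq_bigr => k _; rewrite assoc_stirling2E.
have small n k : (n < k)%N -> (n + k < k.*2)%N by rewrite -addnn ltn_add2r.
have c0 n : (0 < n)%N -> stirling1_assoc (n + 0) 0 = 0%N by case: n => [|[]].
have s0 n : (0 < n)%N -> stirling2_assoc (n + 0) 0 = 0%N by case: n => [|[]].
have cgt n k : (n < k)%N -> stirling1_assoc (n + k) k = 0%N.
  by move/small/stirling1_assoc_small.
have sgt n k : (n < k)%N -> stirling2_assoc (n + k) k = 0%N.
  by move/small/stirling2_assoc_small.
split.
- by move=> n n0; rewrite (triangular_root0 c2E c0 cgt) ?(triangular_root0 s2E s0 sgt).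
(* At [N = n + k] the common factor [N.+1] equals both [a n + k] and [n.+1 + k] for [a n = n.+1]. *)
- apply: (triangular_interlacing c2E c0 cgt (a := S)) => //.
    by move=> [|n] k // _; rewrite !addSn !addnS stirling1_assocS; lia.
  by move=> n _; rewrite /= ltnS leqnn.
(* Here the factor of [u n k.+1] is [k.+1], whence the constant [a n = 1]. *)
- apply: (triangular_interlacing s2E s0 sgt (a := fun=> 1%N)) => //.
  by move=> [|n] k // _; rewrite !addSn !addnS stirling2_assocS; lia.
Qed.
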